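(* Let $\mathbf u\in\mathcal A$, let $\mathcal I$ be a translation invariant free $P$-ideal of $\mathbb N$, and let $x\in[0,1)$ be such that $S=\operatorname{supp}(x)$ is $b$-divergent mod $\mathcal I$. Then $\bar x\in t_{\mathbf u}^{\mathcal I}(\mathbb T)$ if and only if both of the following conditions hold: (I) either $S\in\mathcal I$, or $S\notin\mathcal I$ and there exists $D\subseteq_{\mathcal I}S$ such that $\lim_{n\in D}\varphi\left(\frac{c_n}{b_n}\right)=0$ in $\mathbb T$; (II) for every $D\in\mathcal P(\mathbb N)\setminus\mathcal I$ with $D\subseteq^{\mathcal I}S$ and $D-1$ $b$-bounded, there exists $D'\subseteq_{\mathcal I}D$ such that $\lim_{n\in D'}\frac{c_n}{b_n}=0$.
   Context: $\mathbb N=\{0,1,2,\dots\}$, $\mathbb N_+=\mathbb N\setminus\{0\}$, $\mathbb T=\mathbb R/\mathbb Z$ is the circle group, $\varphi:\mathbb R\to\mathbb T$ is the canonical projection, and $\bar x=\varphi(x)$. $\mathcal A$ is the family of arithmetic sequences: strictly increasing sequences of integers $\mathbf u=(u_n)_{n\in\mathbb N}$ with $u_0=1$ and $u_n\mid u_{n+1}$ for all $n$. Put $b_n=u_n/u_{n-1}$ for $n\in\mathbb N_+$. Every $x\in[0,1)$ has a unique representation $x=\sum_{n=1}^\infty c_n/u_n$ with $c_n\in\mathbb N$, $c_n<b_n$ for all $n\in\mathbb N_+$, and $c_n<b_n-1$ for infinitely many $n$; $\operatorname{supp}(x)=\{n\in\mathbb N_+:c_n\ne0\}$. For $A\subseteq\mathbb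 N$ and $k\in\mathbb Z$, $A+k$ denotes $\{a+k:a\in A\}\cap\mathbb N$. An infinite $A\subseteq\mathbb N$ is $b$-bounded (resp. $b$-divergent) if $(b_n)_{n\in A}$ is bounded (resp. diverges to infinity), the index $0$ being disregarded; finite sets are also regarded as $b$-bounded. $\lim_{n\in E}$ denotes the limit as $n\to\infty$ along an infinite set $E$ (the index $0$ being disregarded). An ideal $\mathcal I$ of $\mathbb N$ is a non-empty family of subsets of $\mathbb N$ closed under finite unions and subsets (not required to be proper); it is free if it contains all finite sets; it is a $P$-ideal if for every countable family $\{A_n\}\subseteq\mathcal I$ there is $A\in\mathcal I$ with $A_n\setminus A$ finite for all $n$; it is translation invariant if $A\in\mathcal I$ implies $A+k\in\mathcal I$ for all $k\in\mathbb Z$. Write $A\subseteq^{\mathcal I}B$ if $A\setminus B\in\mathcal I$, and $A\subseteq_{\mathcal I}B$ if $A\subseteq B$ and $B\setminus A\in\mathcal I$. A set $X\subseteq\mathbb N$ is $b$-divergent mod $\mathcal I$ if there is a $b$-divergent $A\subseteq_{\mathcal I}X$. $t_{\mathbf u}^{\mathcal I}(\mathbb T)$ is the set of $z\in\mathbb T$ such that $\{n\in\mathbb N:u_nz\notin U\}\in\mathcal I$ for every neighborhood $U$ of $0$ in $\mathbb T$. *)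

(* Defs.v *)
From HB Require Import structures.
From mathcomp Require Import all_boot all_order all_algebra.
From mathcomp Require Import all_classical all_reals all_analysis.

Set Implicit Arguments.
Unset Strict Implicit.
Unset Printing Implicit Defensive.

Import Order.TTheory GRing.Theory Num.Theory numFieldNormedType.Exports.

Local Open Scope classical_set_scope.
Local Open Scope quotient_scope.
Local Open Scope ring_scope.

(* The circle group R/Z, with the quotient group structure and the quotient
   topology; [Quotient.quot I] is the quotient of a zmodType by the additive
   subgroup I, here the integers of R. *)
Definition int_pred (R : realType) : zmodClosed R :=
  GRing.ZmodClosed.clone R (@Num.int_num_subdef R) _.

Definition circle (R : realType) : Type :=
  quotient_topology (Quotient.quot (int_pred R)).

HB.instance Definition _ (R : realType) := Topological.on (circle R).
HB.instance Definition _ (R : realType) := GRing.isZmodule.Build (circle R)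
  (@Quotient.addqA R (int_pred R)) (@Quotient.addqC R (int_pred R))
  (@Quotient.add0q R (int_pred R)) (@Quotient.addNq R (int_pred R)).

Definition circle_proj (R : realType) (x : R) : circle R := \pi_(circle R) x.

Definition arithmetic_seq (u : nat -> int) : Prop :=
  [/\ u 0%N = 1, (forall n, u n < u n.+1) & (forall n, (u n %| u n.+1)%Z)].

(* Meaningful only for n > 0: [b_seq u 0] is a junk value, which every
   definition below disregards. *)
Definition b_seq (u : nat -> int) (n : nat) : int := (u n %/ u n.-1)%Z.

(* c is the canonical digit sequence of x; it exists and is unique (up to the
   irrelevant value c 0) for every arithmetic sequence u and every x in
   [0, 1[. *)
Definition is_expansion (R : realType) (u : nat -> int) (x : R)
    (c : nat -> nat) : Prop :=
  [/\ (\sum_(1 <= n < N.+1) (c n)%:R / (u n)%:~R) @[N --> \oo] --> x,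
      (forall n, (0 < n)%N -> (c n)%:Z < b_seq u n) &
      infinite_set [set n | (0 < n)%N /\ (c n)%:Z < b_seq u n - 1]].

Definition supp (c : nat -> nat) : set nat := [set n | (0 < n)%N /\ c n <> 0%N].

Definition translate (A : set nat) (k : int) : set nat :=
  [set m | exists2 a, A a & m%:Z = a%:Z + k].

(* Finite sets satisfy this automatically. *)
Definition b_bounded (u : nat -> int) (A : set nat) : Prop :=
  exists M : int, forall n, A n -> (0 < n)%N -> b_seq u n <= M.

Definition b_divergent (u : nat -> int) (A : set nat) : Prop :=
  infinite_set A /\ forall M : int, \forall n \near within A \oo, M <= b_seq u n.

Definition lim_along (T : topologicalType) (E : set nat) (f : nat -> T) (l : T)
    : Prop :=
  infinite_set E /\ f n @[n --> within E \oo] --> l.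

Definition is_ideal (I : set (set nat)) : Prop :=
  [/\ I !=set0, (forall A B, I A -> I B -> I (A `|` B)) &
      (forall A B, A `<=` B -> I B -> I A)].

Definition free_ideal (I : set (set nat)) : Prop :=
  forall A, finite_set A -> I A.

Definition P_ideal (I : set (set nat)) : Prop :=
  forall A_ : nat -> set nat, (forall n, I (A_ n)) ->
    exists2 A, I A & forall n, finite_set (A_ n `\` A).

Definition translation_invariant (I : set (set nat)) : Prop :=
  forall A (k : int), I A -> I (translate A k).

(* almost_subset I A B is "A \subseteq^I B", whereas big_subset I A B is
   "A \subseteq_I B". *)
Definition almost_subset (I : set (set nat)) (A B : set nat) : Prop :=
  I (A `\` B).

Definition big_subset (I : set (set nat)) (A B : set nat) : Prop :=
  A `<=` B /\ I (B `\` A).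

Definition b_divergent_mod (u : nat -> int) (I : set (set nat)) (X : set nat)
    : Prop :=
  exists2 A, b_divergent u A & big_subset I A X.

(* The topologically u-torsion elements of the circle modulo I. *)
Definition torsion_mod (R : realType) (u : nat -> int) (I : set (set nat))
    : set (circle R) :=
  [set z | forall U, nbhs (0 : circle R) U -> I [set n | ~ U (z *~ u n)]].
Arguments torsion_mod : clear implicits.

(* Main.v *)
Require Import Defs.
From mathcomp Require Import all_boot all_order all_algebra.
From mathcomp Require Import all_classical all_reals all_analysis.
From mathcomp Require Import zify ring lra.
Import Order.TTheory GRing.Theory Num.Theory numFieldNormedType.Exports.
Local Open Scope classical_set_scope.
Local Open Scope ring_scope.

(* The tails r n = c_(n+1)/b_(n+1) + c_(n+2)/(b_(n+1) b_(n+2)) + ... lie in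
   [0, 1], represent u_n x modulo the integers, and satisfy
   r n = (c_(n+1) + r (n+1)) / b_(n+1).  Since b is large on the support modulo I,
   r n is close to c_(n+1)/b_(n+1) when n+1 is in S, which yields (I).  When n+1
   is not in S, r n = r (n+1) / b_(n+1): if b_(n+1) is bounded, then r n is close
   to an integer only if r (n+1) is close to 0, and not to 1, which yields (II).
   Conversely, walking right from n until the support is met, each step off the
   support at least halves r, and the last one makes r small either because
   b is large there or because of (II). *)

(** * Ratios of an arithmetic sequence and tails of the expansion *)

Lemma arithmetic_seq_gt0 (u : nat -> int) : arithmetic_seq u ->
  forall n, 0 < u n.
Proof.
by case=> u0 ult _; elim=> [|n IH]; [rewrite u0 | exact: lt_trans (ult n)].
Qed.

Lemma b_seqM (u : nat -> int) (n : nat) : arithmetic_seq u ->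
  b_seq u n.+1 * u n = u n.+1.
Proof. by case=> _ _ udvd; rewrite /b_seq divzK. Qed.

Lemma b_seq_ge2 (u : nat -> int) (n : nat) : arithmetic_seq u ->
  2 <= b_seq u n.+1.
Proof.
move=> hu; have un := arithmetic_seq_gt0 _ hu n.
case: (hu) => _ /(_ n) ult _; move: ult; rewrite -(b_seqM _ n hu) => ult.
have : 1 < b_seq u n.+1 by rewrite -(ltr_pM2r un) mul1r.
lia.
Qed.

Lemma b_seqR_ge2 (R : realType) (u : nat -> int) (n : nat) : arithmetic_seq u ->
  (2 : R) <= (b_seq u n.+1)%:~R.
Proof. by move=> hu; have := b_seq_ge2 _ n hu; rewrite -(ler_int R). Qed.

(** Subtracting the partial sum, instead of summing a series, makes the recursion [tailS] pure
    algebra; convergence enters only in the bounds. *)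
Definition tail (R : realType) (u : nat -> int) (c : nat -> nat) (x : R)
    (n : nat) : R :=
  (u n)%:~R * (x - \sum_(1 <= k < n.+1) (c k)%:R / (u k)%:~R).

Lemma tailS (R : realType) (u : nat -> int) (c : nat -> nat) (x : R) (n : nat) :
  arithmetic_seq u ->
  tail R u c x n = ((c n.+1)%:R + tail R u c x n.+1) / (b_seq u n.+1)%:~R.
Proof.
move=> hu; rewrite /tail [in RHS]big_nat_recr //= -(b_seqM _ n hu) intrM.
have b2 := b_seqR_ge2 R _ n hu.
have un : (0 : R) < (u n)%:~R by rewrite ltr0z arithmetic_seq_gt0.
by field; rewrite !lt0r_neq0 // (lt_le_trans _ b2).
Qed.

Lemma tail_ge0 (R : realType) (u : nat -> int) (c : nat -> nat) (x : R)
    (n : nat) : arithmetic_seq u -> is_expansion u x c ->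
  0 <= tail R u c x n.
Proof.
move=> hu [hx _ _]; have u0 k : (0 : R) < (u k)%:~R.
  by rewrite ltr0z arithmetic_seq_gt0.
apply: mulr_ge0; first exact: ltW.
rewrite subr_ge0 -(cvg_lim (@Rhausdorff R) hx).
apply: limr_ge; first by apply/cvg_ex; exists x.
near=> N; rewrite (@big_cat_nat _ _ _ n.+1 1 N.+1) //= ?lerDl.
  by apply: sumr_ge0 => k _; rewrite divr_ge0 // ltW.
by near: N; exact: nbhs_infty_ge.
Unshelve. all: by end_near. Qed.

(* The digits [b_k - 1] make the series telescope: (b_k - 1)/u_k = 1/u_{k-1} - 1/u_k. *)
Lemma tail_le1 (R : realType) (u : nat -> int) (c : nat -> nat) (x : R)
    (n : nat) : arithmetic_seq u -> is_expansion u x c ->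
  tail R u c x n <= 1.
Proof.
move=> hu [hx hlt _]; have u0 k : (0 : R) < (u k)%:~R.
  by rewrite ltr0z arithmetic_seq_gt0.
rewrite /tail -ler_pdivlMl // mulr1 lerBlDl -(cvg_lim (@Rhausdorff R) hx).
apply: limr_le; first by apply/cvg_ex; exists x.
near=> N; have nN : (n <= N)%N by near: N; exact: nbhs_infty_ge.
rewrite (@big_cat_nat _ _ _ n.+1 1 N.+1) //= lerD2l.
apply: (@le_trans _ _ ((u n)%:~R^-1 - (u N)%:~R^-1)); last first.
  by rewrite gerBl invr_ge0 ltW.
rewrite -opprB -(telescope_sumr (fun k => (u k)%:~R^-1 : R)) //.
rewrite -sumrN big_add1 /=; apply: ler_sum => k _.
have b2 := b_seqR_ge2 R _ k hu.
have ck : ((c k.+1)%:R : R) <= (b_seq u k.+1)%:~R - 1.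
  have := hlt k.+1 isT; rewrite -lezD1 -(ler_int R) rmorphD /= => ?; lra.
have uk := u0 k; have -> : - ((u k.+1)%:~R^-1 - (u k)%:~R^-1) =
    ((b_seq u k.+1)%:~R - 1) / (u k.+1)%:~R :> R.
  rewrite -(b_seqM _ k hu) intrM; field.
  by rewrite !lt0r_neq0 // (lt_le_trans _ b2).
by rewrite ler_pM2r // invr_gt0.
Unshelve. all: by end_near. Qed.

(** * Distance to the integers and the topology of the circle *)

Definition near_int (R : realType) (e t : R) : Prop :=
  exists k : int, `|t - k%:~R| < e.

Lemma near_intW (R : realType) (e e' t : R) :
  e <= e' -> near_int R e t -> near_int R e' t.
Proof. by move=> ee' [k kt]; exists k; exact: lt_le_trans ee'. Qed.

Lemma near_intD (R : realType) (e e' t s : R) :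
  near_int R e t -> `|s| <= e' -> near_int R (e + e') (t + s).
Proof.
move=> [k kt] se; exists k; rewrite addrAC.
exact: le_lt_trans (ler_normD _ _) (ltr_leD kt se).
Qed.

(** The bounds put the nearby integer strictly between -1 and 1, so it is 0; closeness to 1 is ruled
    out. *)
Lemma near_int_le_half (R : realType) (e t : R) :
  near_int R e t -> 0 <= t -> t <= 2^-1 -> e <= 2^-1 -> t < e.
Proof.
move=> [k]; rewrite ltr_norml => /andP[kt tk] t0 t2 e2.
have : (-1 : R) < k%:~R by lra.
have : (k%:~R : R) < 1 by lra.
rewrite (ltrz1 R) -[-1]/((-1)%:~R) ltr_int => k1 k0.
by have k00 : k = 0 by [lia]; rewrite k00 subr0 in tk.
Qed.

Lemma circle_projD (R : realType) (x y : R) :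
  circle_proj (x + y) = circle_proj x + circle_proj y.
Proof. exact: (@Quotient.pi_add R (int_pred R)). Qed.

Lemma circle_proj0 (R : realType) : circle_proj (0 : R) = 0.
Proof. by apply: (addrI (circle_proj 0)); rewrite -circle_projD !addr0. Qed.

Lemma circle_projMz (R : realType) (x : R) (k : int) :
  circle_proj (x *~ k) = circle_proj x *~ k.
Proof.
have proj_nat (n : nat) : circle_proj (x *+ n) = circle_proj x *+ n.
  by elim: n => [|n IH]; rewrite ?mulr0n ?circle_proj0 // !mulrS circle_projD IH.
case: k => n; first by rewrite -!pmulrn.
rewrite !NegzE !mulrNz -!pmulrn -proj_nat.
by apply: (addrI (circle_proj (x *+ n.+1))); rewrite -circle_projD !subrr circle_proj0.
Qed.

Lemma circle_proj_eq (R : realType) (x y : R) :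
  circle_proj x = circle_proj y <-> exists k : int, x - y = k%:~R.
Proof.
have E := Quotient.idealrBE (int_pred R) x y.
split=> [xy|/intrP xy]; last first.
  by move: xy; rewrite -[_ \is a _]/(x - y \in int_pred R) E => /eqP.
by apply/intrP; rewrite -[_ \is a _]/(x - y \in int_pred R) E; exact/eqP.
Qed.

Lemma near_int_proj (R : realType) (e x y : R) :
  circle_proj x = circle_proj y -> near_int R e x -> near_int R e y.
Proof.
move=> /circle_proj_eq[k xy] [l xl]; exists (l - k).
have -> : y - (l - k)%:~R = x - l%:~R by rewrite intrB -xy; ring.
exact: xl.
Qed.

Lemma nbhs_circle0P (R : realType) (U : set (circle R)) :
  nbhs (0 : circle R) U <->
  exists2 e : R, 0 < e & forall t, near_int R e t -> U (circle_proj t).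
Proof.
split=> [U0|[e e0 eU]].
  have cont : {for 0, continuous (@circle_proj R)} by exact: pi_continuous.
  have : nbhs (circle_proj (0 : R)) U by rewrite circle_proj0.
  move=> /cont /nbhs_ballP[e e0 eU]; exists e => // t [k kt].
  have -> : circle_proj t = circle_proj (t - k%:~R).
    by apply/circle_proj_eq; exists k; rewrite opprB addrC subrK.
  by apply: eU; rewrite /ball/= sub0r normrN.
rewrite nbhsE; exists [set circle_proj t | t in near_int R e]; last first.
  by move=> _ [t et <-]; exact: eU.
split; last first.
  by exists 0; rewrite ?circle_proj0 //; exists 0; rewrite subr0 normr0.
(* A set is open in the quotient when its preimage is; here the preimage is [near_int R e] itself,
   which is invariant under integer translations. *)
suff : open (near_int R e).
  congr open; apply/seteqP; split=> t /=; first by exists t.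
  by case=> s es st; exact: near_int_proj es.
have -> : near_int R e = \bigcup_(k : int) ball (k%:~R : R) e.
  apply/seteqP; split=> t /=.
    by case=> k kt; exists k => //; rewrite /ball/= distrC.
  by case=> k _ kt; exists k; rewrite distrC.
by apply: bigcup_open => k _; exact: ball_open.
Qed.

(** Each [u k] with [k <= n] divides [u n], so [u n] times the partial sum is an integer and
    vanishes in the circle. *)
Lemma circle_proj_tail (R : realType) (u : nat -> int) (c : nat -> nat) (x : R)
    (n : nat) : arithmetic_seq u ->
  circle_proj x *~ u n = circle_proj (tail R u c x n).
Proof.
move=> hu; rewrite -circle_projMz; apply/circle_proj_eq.
suff [k kE] : exists k : int,
    (u n)%:~R * (\sum_(1 <= k < n.+1) (c k)%:R / (u k)%:~R) = k%:~R :> R.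
  by exists k; rewrite -kE /tail mulrBr mulrzl opprB addrC subrK.
elim: n => [|n [k kE]]; first by exists 0; rewrite big_geq // mulr0.
exists (b_seq u n.+1 * k + (c n.+1)%:Z).
rewrite big_nat_recr //= mulrDr rmorphD /= intrM -kE.
rewrite [_%:~R * (_%:~R * _)]mulrA -intrM b_seqM //.
have un : (u n.+1)%:~R != 0 :> R by rewrite intr_eq0 gt_eqF ?arithmetic_seq_gt0.
by rewrite mulrCA divff // mulr1.
Qed.

(** * Limits along infinite sets as finiteness of exceptional sets *)

Lemma near_within_oo (D P : set nat) :
  (\forall n \near within D \oo, P n) <-> finite_set (D `\` P).
Proof.
split=> [[N _ NP]|].
  apply: (@sub_finite_set _ _ `I_N); last exact: finite_II.
  by move=> n [Dn Pn] /=; rewrite ltnNge; apply/negP => /NP /(_ Dn).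
move=> /finite_seqP[X DX]; exists (\max_(i <- X) i).+1 => // n /= ltn Dn.
apply: contrapT => Pn; have : (D `\` P) n by [].
rewrite DX /= => nX; move: ltn; rewrite ltnNge => /negP; apply.
exact: leq_bigmax_seq.
Qed.

Lemma lim_along_circleP (R : realType) (D : set nat) (f : nat -> R) :
  lim_along D (fun n => circle_proj (f n)) (0 : circle R) <->
  infinite_set D /\ forall e : R, 0 < e ->
    finite_set (D `\` [set n | near_int R e (f n)]).
Proof.
split=> -[Dinf Df]; split=> //.
  move=> e e0; apply/near_within_oo.
  have /Df : nbhs (0 : circle R) [set circle_proj t | t in near_int R e].
    by apply/nbhs_circle0P; exists e => // t et; exists t.
  apply: (@filterS _ (within D \oo)) => n [t et tn].
  exact: near_int_proj et.
move=> U /nbhs_circle0P[e e0 eU].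
have /near_within_oo := Df e e0.
by apply: (@filterS _ (within D \oo)) => n; exact: eU.
Qed.

Lemma lim_along0P (R : realType) (D : set nat) (f : nat -> R) :
  lim_along D f (0 : R) <->
  infinite_set D /\ forall e : R, 0 < e ->
    finite_set (D `\` [set n | `|f n| < e]).
Proof.
split=> -[Dinf Df]; split=> //.
  move=> e e0; apply/near_within_oo.
  by have /cvgr0Pnorm_lt /(_ e e0) := Df.
by apply/cvgr0Pnorm_lt => e e0; exact/near_within_oo/Df.
Qed.

(** * Ideals, the P-property and the dual filter *)

Lemma big_subset_infinite (I : set (set nat)) (D E : set nat) :
  is_ideal I -> free_ideal I -> ~ I E -> big_subset I D E -> infinite_set D.
Proof.
move=> [_ IU Isub] hfree IE [DE IED] Dfin; apply: IE.
apply: (Isub _ (D `|` E `\` D)); last by apply: IU => //; exact: hfree.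
by move=> n En; case: (pselect (D n)) => Dn; [left | right].
Qed.

(** Trades one set that serves every [e] for a separate condition at each [e]. The P-property
    absorbs the exceptional sets for [e = 1/(k+1)], up to finite sets, into a single [A] in [I], and
    [E] minus [A] works. *)
Lemma P_ideal_limP (R : realType) (I : set (set nat)) (E : set nat)
    (P : R -> set nat) : is_ideal I -> free_ideal I -> P_ideal I ->
  (forall e e', e <= e' -> P e `<=` P e') ->
  (exists2 D, big_subset I D E & forall e, 0 < e -> finite_set (D `\` P e)) <->
  (forall e, 0 < e -> I (E `\` P e)).
Proof.
move=> [_ IU Isub] hfree hP Pmono; split=> [[D [DE ID] DP] e e0|EP].
  apply: (Isub _ (D `\` P e `|` E `\` D)).
    by move=> n [En Pn]; case: (pselect (D n)) => Dn; [left | right].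
  by apply: IU => //; exact/hfree/DP.
have [k|A IA AP] := hP (fun k => E `\` P k.+1%:R^-1).
  by apply: EP; rewrite invr_gt0.
exists (E `\` A).
  split; first by move=> n [].
  by apply: Isub IA => n [En]; apply: contra_notP.
move=> e e0; have [k ke] : exists k : nat, k.+1%:R^-1 <= e.
  exists (Num.truncn e^-1); rewrite invf_ple ?posrE //.
  exact/ltW/truncnS_gt.
apply: sub_finite_set (AP k) => n [[En An] Pn]; split=> //; split=> //.
by apply: contra_not Pn; exact: Pmono.
Qed.

(* The properties that hold for almost all n modulo I; the filter is not proper
   when I contains every set. *)
Definition dual_filter (I : set (set nat)) : set_system nat :=
  [set A | I (~` A)].

Lemma dual_filter_filter (I : set (set nat)) : is_ideal I ->
  Filter (dual_filter I).
Proof.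
case=> [[A IA]] IU Isub; split; rewrite /dual_filter /mkset.
- by rewrite setCT; apply: Isub IA.
- by move=> P Q IP IQ; rewrite setCI; exact: IU.
- by move=> P Q PQ; apply: Isub; exact: subsetC.
Qed.

Lemma dual_filter_shift (I : set (set nat)) (P : set nat) :
  is_ideal I -> translation_invariant I ->
  (\forall n \near dual_filter I, P n) -> \forall n \near dual_filter I, P n.+1.
Proof.
case=> _ _ Isub htr /(htr _ (-1)); apply: Isub => n /= Pn.
by exists n.+1; rewrite //=; lia.
Qed.

Lemma dual_filter_unshift (I : set (set nat)) (P : set nat) :
  is_ideal I -> free_ideal I -> translation_invariant I ->
  (\forall n \near dual_filter I, P n.+1) -> \forall n \near dual_filter I, P n.
Proof.
case=> _ IU Isub hfree htr /(htr _ 1) IP.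
(* The translate cannot account for 0, which has no predecessor; freeness of [I] supplies it. *)
apply: (Isub _ _ _ (IU _ _ IP (hfree _ (finite_set1 0%N)))).
move=> [|n] /= Pn; [by right | left].
by exists n; rewrite //=; lia.
Qed.

(** * Torsion, divergence and digits along the dual filter *)

Lemma torsion_modP (R : realType) (u : nat -> int) (I : set (set nat))
    (c : nat -> nat) (x : R) : arithmetic_seq u -> is_ideal I ->
  torsion_mod R u I (circle_proj x) <->
  forall e : R, 0 < e -> \forall n \near dual_filter I, near_int R e (tail R u c x n).
Proof.
move=> hu [_ _ Isub]; split=> [tors e e0|tors U /nbhs_circle0P[e e0 eU]].
  apply: (Isub _ _ _ (tors [set circle_proj t | t in near_int R e] _)).
    move=> n /= en [t et]; rewrite (circle_proj_tail _ _ c) // => tn.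
    exact/en/(near_int_proj _ _ _ _ tn).
  by apply/nbhs_circle0P; exists e => // t et; exists t.
apply: (Isub _ _ _ (tors e e0)) => n /=; rewrite (circle_proj_tail _ _ c) //.
by apply: contra_not; exact: eU.
Qed.

Lemma b_divergent_mod_near (u : nat -> int) (I : set (set nat)) (X : set nat)
    (M : int) : is_ideal I -> free_ideal I -> b_divergent_mod u I X ->
  \forall n \near dual_filter I, X n -> M <= b_seq u n.
Proof.
move=> [_ IU Isub] hfree [A [_ /(_ M)/near_within_oo/hfree IM] [AX IA]].
apply: (Isub _ _ _ (IU _ _ IM IA)) => n /= /not_implyP[Xn Mn].
by case: (pselect (A n)) => An; [left | right].
Qed.

(** The difference is [r (n+1) / b_(n+1)], and the next tail lies in [0, 1]. *)
Lemma tail_digit (R : realType) (u : nat -> int) (c : nat -> nat) (x : R)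
    (n : nat) : arithmetic_seq u -> is_expansion u x c ->
  0 <= tail R u c x n - (c n.+1)%:R / (b_seq u n.+1)%:~R
    <= (b_seq u n.+1)%:~R^-1.
Proof.
move=> hu hc; have b2 := b_seqR_ge2 R _ n hu.
have -> : tail R u c x n - (c n.+1)%:R / (b_seq u n.+1)%:~R =
    tail R u c x n.+1 / (b_seq u n.+1)%:~R.
  by rewrite tailS // mulrDl addrC addKr.
have b0 : (0 : R) < (b_seq u n.+1)%:~R by lra.
rewrite divr_ge0 ?(ltW b0) ?tail_ge0 //= ler_pdivrMr // mulVf ?gt_eqF //.
exact: tail_le1.
Qed.

Lemma b_seq_inv_le (R : realType) (u : nat -> int) (e : R) (n : nat) :
  0 < e -> (Num.truncn e^-1).+1%:Z <= b_seq u n -> (b_seq u n)%:~R^-1 <= e.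
Proof.
move=> e0; rewrite -(ler_int R) => bM.
have : e^-1 < (Num.truncn e^-1).+1%:R := truncnS_gt _.
rewrite -pmulrn in bM => /lt_le_trans/(_ bM) be.
have b0 : (0 : R) < (b_seq u n)%:~R by apply: lt_trans be; rewrite invr_gt0.
by rewrite invf_ple ?posrE // ltW.
Qed.

(** * Necessity of the digit conditions *)

Lemma torsion_digits (R : realType) (u : nat -> int) (I : set (set nat))
    (x : R) (c : nat -> nat) : arithmetic_seq u -> is_ideal I -> free_ideal I ->
  translation_invariant I -> is_expansion u x c ->
  b_divergent_mod u I (supp c) ->
  (forall e : R, 0 < e ->
     \forall n \near dual_filter I, near_int R e (tail R u c x n)) ->
  forall e : R, 0 < e -> \forall n \near dual_filter I,
    supp c n -> near_int R e ((c n)%:R / (b_seq u n)%:~R).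
Proof.
move=> hu hI hfree htr hc hS tors e e0; have FI := dual_filter_filter _ hI.
(* The tail at [n] governs the digit at [n+1]. *)
apply: dual_filter_unshift => //.
have e20 : 0 < e / 2 by rewrite divr_gt0.
have := b_divergent_mod_near _ _ _ (Num.truncn (e / 2)^-1).+1%:Z hI hfree hS.
move=> /(dual_filter_shift _ _ hI htr); apply: filterS2 (tors _ e20).
move=> n rn bn /bn /(b_seq_inv_le _ _ _ _ e20) be.
have /andP[d0 db] := tail_digit _ _ _ _ n hu hc.
have := near_intD _ _ (e / 2) _
  ((c n.+1)%:R / (b_seq u n.+1)%:~R - tail R u c x n) rn.
rewrite [_ + (_ - _)]addrC subrK -splitr; apply.
by rewrite distrC ger0_norm // (le_trans db).
Qed.

(* Off an I-small set n + 1 is outside the support, as b is bounded there; so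
   r n = r n.+1 / b n.+1 <= 1/2, and r n is small rather than close to 1. *)
Lemma torsion_bounded_digits (R : realType) (u : nat -> int)
    (I : set (set nat)) (x : R) (c : nat -> nat) (D : set nat) :
  arithmetic_seq u -> is_ideal I -> free_ideal I ->
  translation_invariant I -> is_expansion u x c ->
  b_divergent_mod u I (supp c) ->
  (forall e : R, 0 < e ->
     \forall n \near dual_filter I, near_int R e (tail R u c x n)) ->
  b_bounded u (translate D (- 1)) ->
  forall e : R, 0 < e -> \forall n \near dual_filter I,
    D n -> `|(c n)%:R / (b_seq u n)%:~R : R| < e.
Proof.
move=> hu hI hfree htr hc hS tors [M DM] e e0.
have FI := dual_filter_filter _ hI.
(* The element of [D] is now [n+2], so [n+1] lies in [D - 1], where [b] is bounded, and the tail at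
   [n] is the one to inspect. *)
do 2 (apply: dual_filter_unshift => //).
(* A bound for the ratios on [D - 1] that is positive whatever the sign of [M]. *)
pose K : R := 1 + `|M%:~R|.
have K1 : 1 <= K by rewrite lerDl.
have K0 : 0 < K by exact: lt_le_trans K1.
(* The factor [e / K] pays for multiplying [r n] by [b_(n+1)] to recover [r (n+1)]; the bound 1/2 is
   what [near_int_le_half] requires. *)
pose d := Num.min (e / K) 2^-1.
have d0 : 0 < d by rewrite lt_min divr_gt0 //= invr_gt0 ltr0n.
(* Ratios on the support are eventually at least [M + 1], which contradicts the bound [M] at [n+1]
   unless that digit is 0. *)
have := b_divergent_mod_near _ _ _ (M + 1) hI hfree hS.
move=> /(dual_filter_shift _ _ hI htr); apply: filterS2 (tors _ d0).
move=> n rn Sb Dn.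
have bM : b_seq u n.+1 <= M by apply: DM => //; exists n.+2; rewrite //=; lia.
have c0 : c n.+1 = 0%N.
  by apply: contrapT => cn; have := Sb (conj isT cn); lia.
have b2 := b_seqR_ge2 R _ n hu.
have b0 : (0 : R) < (b_seq u n.+1)%:~R by lra.
have rE := tailS R _ c x n hu; rewrite c0 add0r in rE.
have r1 := tail_le1 _ _ _ _ n.+1 hu hc.
have r0 := tail_ge0 _ _ _ _ n.+1 hu hc.
have r2 : tail R u c x n <= 2^-1 by rewrite rE ler_pdivrMr //; lra.
have rd : tail R u c x n < d.
  apply: near_int_le_half rn _ r2 _; first exact: tail_ge0.
  by rewrite /d ge_min lexx orbT.
have /andP[c1 _] := tail_digit _ _ _ _ n.+1 hu hc.
have b3 := b_seqR_ge2 R _ n.+1 hu.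
rewrite ger0_norm ?divr_ge0 //; last lra.
apply: (@le_lt_trans _ _ (tail R u c x n.+1)); first by rewrite -subr_ge0.
have -> : tail R u c x n.+1 = tail R u c x n * (b_seq u n.+1)%:~R.
  by rewrite rE divfK // gt_eqF.
apply: (@le_lt_trans _ _ (tail R u c x n * K)).
  apply: ler_wpM2l; first exact: tail_ge0.
  apply: (@le_trans _ _ M%:~R); first by rewrite ler_int.
  by rewrite (le_trans (ler_norm _)) // lerDr.
by rewrite -ltr_pdivlMr // (lt_le_trans rd) // /d ge_min lexx.
Qed.

(** * Sufficiency of the digit conditions *)

Lemma digits_torsion (R : realType) (u : nat -> int) (I : set (set nat))
    (x : R) (c : nat -> nat) : arithmetic_seq u -> is_ideal I -> free_ideal I ->
  translation_invariant I -> is_expansion u x c ->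
  b_divergent_mod u I (supp c) ->
  (forall e : R, 0 < e -> \forall n \near dual_filter I,
     supp c n -> near_int R e ((c n)%:R / (b_seq u n)%:~R)) ->
  (forall D : set nat, D `<=` supp c -> b_bounded u (translate D (- 1)) ->
     forall e : R, 0 < e -> \forall n \near dual_filter I,
       D n -> `|(c n)%:R / (b_seq u n)%:~R : R| < e) ->
  forall e : R, 0 < e ->
    \forall n \near dual_filter I, near_int R e (tail R u c x n).
Proof.
move=> hu hI hfree htr hc hS cI cII e e0; have FI := dual_filter_filter _ hI.
have e20 : 0 < e / 2 by rewrite divr_gt0.
have bS := b_divergent_mod_near _ _ _ (Num.truncn (e / 2)^-1).+1%:Z hI hfree hS.
have near_supp : \forall n \near dual_filter I,
    supp c n.+1 -> near_int R e (tail R u c x n).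
  apply: filterS2 (dual_filter_shift _ _ hI htr bS)
    (dual_filter_shift _ _ hI htr (cI _ e20)) => n bn cn Sn.
  have be := b_seq_inv_le _ _ _ _ e20 (bn Sn).
  have /andP[d0 db] := tail_digit _ _ _ _ n hu hc.
  have := near_intD _ _ (e / 2) _
    (tail R u c x n - (c n.+1)%:R / (b_seq u n.+1)%:~R) (cn Sn).
  rewrite [_ + (_ - _)]addrC subrK -splitr; apply.
  by rewrite ger0_norm // (le_trans db).
pose M : int := (Num.truncn e^-1).+1%:Z.
(* The support points where the preceding ratio is too small to make the preceding tail less than
   [e] by itself; (II) is applied to this set. At [n = 1] the test reads the value of [b_seq] at 0,
   which [b_bounded] disregards. *)
pose D := [set n | supp c n /\ b_seq u n.-1 <= M].
have Dbnd : b_bounded u (translate D (- 1)).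
  by exists M => m [a [_ aM] am] m0; rewrite (_ : m = a.-1) //; lia.
have DS : D `<=` supp c by move=> n [].
have small_D : \forall n \near dual_filter I,
    D n.+1 -> tail R u c x n < e.
  apply: filterS2 (dual_filter_shift _ _ hI htr bS)
    (dual_filter_shift _ _ hI htr (cII D DS Dbnd _ e20)) => n bn cn Dn.
  have be := b_seq_inv_le _ _ _ _ e20 (bn (DS _ Dn)).
  have /andP[d0 db] := tail_digit _ _ _ _ n hu hc.
  have := cn Dn; rewrite ltr_norml => /andP[_ c2].
  lra.
(* Moving left through indices outside the support at least halves r, until
   either the support is met or r < e. *)
have halving k : \forall n \near dual_filter I,
    [\/ supp c n.+1, tail R u c x n < e | tail R u c x n <= 2^-1 ^+ k].
  elim: k => [|k /(dual_filter_shift _ _ hI htr) IH].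
    by near=> n; apply: Or33; rewrite expr0; exact: tail_le1.
  apply: filterS2 IH (dual_filter_shift _ _ hI htr small_D) => n IH Dn.
  have [Sn|nS] := pselect (supp c n.+1); first exact: Or31.
  have c0 : c n.+1 = 0%N by apply: contrapT => cn; exact: nS.
  have b2 := b_seqR_ge2 R _ n hu.
  have b0 : (0 : R) < (b_seq u n.+1)%:~R by lra.
  have r1 := tail_le1 _ _ _ _ n.+1 hu hc.
  have r0 := tail_ge0 _ _ _ _ n.+1 hu hc.
  have rE := tailS R _ c x n hu; rewrite c0 add0r in rE.
  have r_half : tail R u c x n <= 2^-1 * tail R u c x n.+1.
    rewrite rE mulrC ler_wpM2r // lef_pV2 ?posrE //.
  case: IH => [Sn|re|rk]; last first.
  - by apply: Or33; rewrite exprS (le_trans r_half) // ler_wpM2l.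
  - by apply: Or32; lra.
  (* The support is met at [n+2]. If [b_(n+1) <= M], then [n+2] is in [D] and [r (n+1)] is already
     small; otherwise dividing by [b_(n+1) > 1/e] makes [r n] small. *)
  apply: Or32; have [bM|bM] := leP (b_seq u n.+1) M.
    have : tail R u c x n.+1 < e by exact: Dn.
    by move=> re; lra.
  apply: (@le_lt_trans _ _ (b_seq u n.+1)%:~R^-1).
    by rewrite rE ler_pdivrMr // mulVf ?gt_eqF.
  rewrite invf_plt ?posrE //; apply: lt_trans (truncnS_gt _) _.
  by rewrite pmulrn ltr_int.
(* The number of halvings depends on [e] alone, so finitely many shifts of the filter suffice. *)
have [k ke] : exists k : nat, 2^-1 ^+ k < e.
  exists (Num.truncn e^-1).+1; rewrite exprVn invf_plt ?posrE ?exprn_gt0 //.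
  apply: lt_trans (truncnS_gt _) _.
  by rewrite -natrX ltr_nat ltn_expl.
apply: filterS2 near_supp (halving k) => n nS [/nS //|re|rk];
  exists 0; rewrite subr0 ger0_norm ?tail_ge0 //.
exact: le_lt_trans ke.
Unshelve. all: by end_near. Qed.

(** * The characterization, with limits along sets rewritten in terms of the dual filter *)

Theorem theorem1p10 (R : realType) (u : nat -> int) (hu : arithmetic_seq u)
    (I : set (set nat)) (hI : is_ideal I) (hfree : free_ideal I)
    (hP : P_ideal I) (htr : translation_invariant I)
    (x : R) (hx : 0 <= x < 1) (c : nat -> nat) (hc : is_expansion u x c)
    (hS : b_divergent_mod u I (supp c)) :
  torsion_mod R u I (circle_proj x) <->
  ((I (supp c) \/
      (~ I (supp c) /\
       exists2 D, big_subset I D (supp c) &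
         lim_along D
           (fun n => circle_proj ((c n)%:R / (b_seq u n)%:~R : R))
           (0 : circle R)))
   /\
   (forall D : set nat, ~ I D -> almost_subset I D (supp c) ->
      b_bounded u (translate D (- 1)) ->
      exists2 D', big_subset I D' D &
        lim_along D' (fun n => (c n)%:R / (b_seq u n)%:~R : R) (0 : R))).
Proof.
pose f n : R := (c n)%:R / (b_seq u n)%:~R.
have Isub := let: And3 _ _ h := hI in h.
(* Matches the exceptional sets of [P_ideal_limP] with the filter form of the digit lemmas. *)
have nearI (E P : set nat) :
    (\forall n \near dual_filter I, E n -> P n) <-> I (E `\` P).
  by split; apply: Isub => n /=; [case=> En Pn /(_ En) | move/not_implyP].
have mono1 (e e' : R) : e <= e' ->
    [set n | near_int R e (f n)] `<=` [set n | near_int R e' (f n)].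
  by move=> ee' n; exact: near_intW.
have mono2 (e e' : R) : e <= e' -> [set n | `|f n| < e] `<=` [set n | `|f n| < e'].
  by move=> ee' n /= /lt_le_trans; exact.
split=> [/(torsion_modP _ _ _ c _ hu hI) tors|[cI cII]].
  split.
    have [|nIS] := pselect (I (supp c)); [by left | right; split=> //].
    have [|D DS Dlim] := (P_ideal_limP R I (supp c) _ hI hfree hP mono1).2.
      move=> e e0; apply/nearI.
      exact: (torsion_digits _ _ _ _ _ hu hI hfree htr hc hS tors).
    exists D => //; apply/lim_along_circleP; split=> //.
    exact: big_subset_infinite DS.
  move=> D nID _ Dbnd.
  have [|D' DD Dlim] := (P_ideal_limP R I D _ hI hfree hP mono2).2.
    move=> e e0; apply/nearI.
    exact: (torsion_bounded_digits _ _ _ _ _ _ hu hI hfree htr hc hS tors Dbnd).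
  exists D' => //; apply/lim_along0P; split=> //.
  exact: big_subset_infinite DD.
apply/(torsion_modP _ _ _ c _ hu hI); apply: digits_torsion => // [e e0|D DS Dbnd e e0].
  apply/nearI; case: cI => [|[_ [D DS /lim_along_circleP[_ Dlim]]]].
    by apply: Isub => n [].
  by apply: (P_ideal_limP R I _ _ hI hfree hP mono1).1 e e0; exists D.
(* Condition (II) speaks only of sets outside [I]; for [D] in [I] the exceptional set is in [I] as a
   subset of [D]. *)
apply/nearI; have [|nID] := pselect (I D); first by apply: Isub => n [].
have [|D' DD /lim_along0P[_ Dlim]] := cII D nID _ Dbnd.
  by apply: hfree; have -> : D `\` supp c = set0 by apply/seteqP; split=> n // [/DS].
by apply: (P_ideal_limP R I _ _ hI hfree hP mono2).1 e e0; exists D'.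
Qed.
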